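(* For all integers $n\ge d\ge 3$, a $d$-braxtope with $n+1$ vertices is realizable in ${\bf R}^d$; that is, there exists a convex $d$-polytope $P\subset{\bf R}^d$ with $n+1$ vertices which is a $d$-braxtope with respect to some vertex array $x_0<x_1<\cdots<x_n$ of $P$.
   Context: $[Y]$ denotes the convex hull of a set $Y\subset {\bf R}^d$, and $[y_1,\ldots,y_s]$ the convex hull of the points $y_1,\dots,y_s$. A vertex array of a polytope $P$ with (distinct) vertices $x_0,\ldots,x_n$ is a total ordering $x_0<x_1<\cdots<x_n$ of its vertex set. Definition. For $n\ge d\ge 3$, a $d$-polytope $P$ with $n+1$ vertices is a $d$-braxtope (with respect to a vertex array $x_0<x_1<\cdots<x_n$) if there is a vertex array $x_0<x_1<\cdots<x_n$ of $P$ such that the facets of $P$ are exactly $$T_i=[x_i,x_{i+1},\ldots,x_{i+d-1}]\quad\text{for } 0\le i\le n-d+1$$ and $$E_j=[x_0,x_{j-(d-2)},\ldots,x_{j-1},x_{j+1},\ldots,x_{j+(d-2)}]\quad\text{for } 2\le j\le n,$$ under the convention $x_t=x_0$ for $t\le 0$ and $x_t=x_n$ for $t\ge n$ (so $E_n=[x_0,x_{n-(d-2)},\ldots,x_{n-1},x_n]$). *)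

(* Defs.v *)
From mathcomp Require Export all_boot all_order all_algebra.
From mathcomp Require Export boolp classical_sets functions cardinality reals.
From mathcomp Require Export convex.

Set Implicit Arguments.
Unset Strict Implicit.
Unset Printing Implicit Defensive.

Import Order.TTheory GRing.Theory Num.Theory.

Local Open Scope classical_set_scope.
Local Open Scope ring_scope.

Section Polytopes.
Context {R : realType} {e : nat}.
Implicit Types (Y P F : set 'rV[R]_e) (v : 'rV[R]_e).

Definition convex_hull Y : set 'rV[R]_e :=
  smallest (@convex_set R 'rV[R]_e) Y.

Definition affine_set Y : Prop :=
  forall u v (t : R), Y u -> Y v -> Y ((1 - t) *: u + t *: v).

Definition affine_hull Y : set 'rV[R]_e := smallest affine_set Y.

(* The affine hull of Y is a translate of a k-dimensional linear subspace,
   given as the row space of V; the empty set has no dimension. *)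
Definition has_dim Y (k : nat) : Prop :=
  exists (v : 'rV[R]_e) (V : 'M[R]_e),
    \rank V = k /\ affine_hull Y = [set u | (u - v <= V)%MS].

Definition is_polytope (d : nat) P : Prop :=
  (exists2 Y : set 'rV[R]_e, finite_set Y & P = convex_hull Y) /\ has_dim P d.

Definition dotr (a v : 'rV[R]_e) : R := \sum_(i < e) a 0 i * v 0 i.

(* The vector a may be zero, so set0 and P itself are (improper) faces. *)
Definition is_face P F : Prop :=
  exists (a : 'rV[R]_e) (b : R),
    (forall v, P v -> dotr a v <= b) /\ F = P `&` [set v | dotr a v = b].

Definition vertices P : set 'rV[R]_e := [set v | is_face P [set v]].

Definition is_facet P F : Prop :=
  is_face P F /\ exists2 k, has_dim P k.+1 & has_dim F k.

Section VertexArray.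
Context {n : nat}.
Implicit Type x : 'I_n.+1 -> 'rV[R]_e.

(* The total order on the vertices is the one transported from 'I_n.+1. *)
Definition vertex_array P x : Prop := injective x /\ vertices P = range x.

(* x_t, with x_t = x_n for t >= n; the convention x_t = x_0 for t <= 0 is
   covered by truncated subtraction in the index. *)
Definition vtx x (t : nat) : 'rV[R]_e := x (inord (minn t n)).

Definition facetT (d : nat) x (i : nat) : set 'rV[R]_e :=
  convex_hull [set vtx x (i + k) | k in [set k | (k <= d - 1)%N]].

Definition facetE (d : nat) x (j : nat) : set 'rV[R]_e :=
  convex_hull ([set vtx x 0]
    `|` [set vtx x (j - k) | k in [set k | (1 <= k <= d - 2)%N]]
    `|` [set vtx x (j + k) | k in [set k | (1 <= k <= d - 2)%N]]).

Definition braxtope (d : nat) P x : Prop :=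
  [/\ (3 <= d <= n)%N,
      is_polytope d P,
      vertex_array P x &
      forall F, is_facet P F <->
        (exists2 i, (i <= n - d + 1)%N & F = facetT d x i) \/
        (exists2 j, (2 <= j <= n)%N & F = facetE d x j)].

End VertexArray.
End Polytopes.

(* Main.v *)
Require Import Defs.
From mathcomp Require Import interval_inference zify ring lra.

Set Implicit Arguments.
Unset Strict Implicit.
Unset Printing Implicit Defensive.

Import Order.TTheory GRing.Theory Num.Theory.

Local Open Scope classical_set_scope.
Local Open Scope ring_scope.

(** Let D = d - 1. Everything is expressed through sequences x satisfying
      x (m + D + 1) = 2 x (m + D) + 2 x (m + 1) - x m + lam
    for some constant lam. They form a space of dimension d + 1, in which x is
    determined by lam and any D + 1 consecutive values; it is identified with
    the space of affine functions on the d-dimensional space. Under this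
    identification, evaluating x at k + D (1 <= k <= n) and taking its constant
    lam are, up to positive factors, the evaluations of an affine function at
    points x_k and x_0, and these are the vertices. Facets are therefore found
    by exhibiting sequences that are nonnegative on the indices D + 1, ..., D + n
    and vanish at prescribed places. The shift by D, omitted from the notation
    below, leaves room for the window 0, ..., D, whose values serve as
    coordinates; the solution with lam = 1 that vanishes on this window is
    positive after it and plays the role of the constant function 1.

    The recurrence is chosen to be invariant under reversal of the index and
    under shifts, and to have solutions with few sign changes. There are
    three kinds of these. The solution seqT i with lam = 1 vanishing at
    i, ..., i + D is positive elsewhere; it gives the facet T_i. The solution
    seqE j with lam = 0, equal to 1 at j and vanishing at distance 1, ..., D - 1
    from j, is positive elsewhere; it gives E_j. The solution seqG i with
    lam = 0 vanishing at i, ..., i + D - 1 is positive after and negative before;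
    at the two ends of the index range it has constant sign and gives the
    facets T_0 and E_n.

    It remains to see that these inequalities cut out the convex hull P of the
    points. For each i the points x_0, x_i, ..., x_{i+D} span a simplex, with
    barycentric coordinates seqT i, - seqG (i + 1), seqE (i + 1), ...,
    seqE (i + D - 1), seqG i up to positive factors (bary_decomposition). At a
    point satisfying all the inequalities, seqG is nonnegative at the first
    index and nonpositive at the last one, so it changes sign between some
    i and i + 1 (sign_change), and the point lies in the i-th simplex
    (ineqs_complete). Seen from x_0, this is the triangulation of a multiplex
    by simplices on consecutive vertices.

    The passage from such a system of inequalities to the facets in the sense of
    supporting hyperplanes is is_facet_hull_zero_set; the vertices are obtained
    from vertices_convex_hull, because the facets separate them
    (ineqs_separate). *)

(** * Convex hulls, faces and dimension *)

Section Hulls.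
Context {R : realType} {e : nat}.
Implicit Types (Y P F : set 'rV[R]_e) (u v : 'rV[R]_e) (h : 'rV[R]_e * R).

(** The elementary form of convexity, with a real parameter in place of an element
    of the bundled unit interval. *)
Lemma convex_setP Y : convex_set Y <->
  forall u v (t : R), 0 <= t <= 1 -> Y u -> Y v -> Y (t *: u + (1 - t) *: v).
Proof.
split=> [cY u v t /andP[t0 t1] Yu Yv|cY u v t].
  have := cY u v (Itv01 t0 t1); rewrite !inE.
  by apply.
rewrite !inE => Yu Yv; apply: cY => //.
by apply/andP; split.
Qed.

Lemma sub_convex_hull Y : Y `<=` convex_hull Y.
Proof. exact: sub_gen_smallest. Qed.

Lemma convex_hull_min Y (A : set 'rV[R]_e) : convex_set A -> Y `<=` A -> convex_hull Y `<=` A.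
Proof. by move=> cA YA u; apply. Qed.

Lemma sub_affine_hull Y : Y `<=` affine_hull Y.
Proof. exact: sub_gen_smallest. Qed.

Lemma affine_hull_min Y (A : set 'rV[R]_e) : affine_set A -> Y `<=` A -> affine_hull Y `<=` A.
Proof. by move=> cA YA u; apply. Qed.

Lemma convex_hull_convex Y : convex_set (convex_hull Y).
Proof.
apply/convex_setP => u v t t01 Yu Yv A [cA YA].
have /convex_setP cA' := cA.
exact: (cA' _ _ _ t01 (Yu A (conj cA YA)) (Yv A (conj cA YA))).
Qed.

Lemma affine_hull_affine Y : affine_set (affine_hull Y).
Proof.
move=> u v t Yu Yv A [cA YA].
exact: (cA _ _ _ (Yu A (conj cA YA)) (Yv A (conj cA YA))).
Qed.

Lemma affine_convex Y : affine_set Y -> convex_set Y.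
Proof.
move=> aY; apply/convex_setP => u v t _ Yu Yv.
by have := aY _ _ (1 - t) Yu Yv; rewrite subKr.
Qed.

(** The term at u0 is singled out because a partial sum of weights may
    vanish, and then u0 serves as the point of weight zero. *)
Lemma convex_set_sum Y (I : Type) (r : seq I) (c0 : R) u0 (c : I -> R)
    (p : I -> 'rV[R]_e) :
  convex_set Y -> Y u0 -> 0 <= c0 -> (forall a, 0 <= c a) ->
  (forall a, c a != 0 -> Y (p a)) -> c0 + \sum_(a <- r) c a = 1 ->
  Y (c0 *: u0 + \sum_(a <- r) c a *: p a).
Proof.
move=> /convex_setP cY Yu0 c00 c_ge0 cp c1.
suff [u Yu ->] : exists2 u, Y u &
    c0 *: u0 + \sum_(a <- r) c a *: p a = (c0 + \sum_(a <- r) c a) *: u.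
  by rewrite c1 scale1r.
elim: r {c1} => [|a r [u Yu IH]]; first by exists u0 => //; rewrite !big_nil !addr0.
rewrite !big_cons ![c0 *: _ + (_ + _)]addrCA ![c0 + (_ + _)]addrCA IH.
set S := c0 + _.
have S0 : 0 <= S by rewrite addr_ge0// sumr_ge0.
have [ca0|ca0] := eqVneq (c a) 0.
  by exists u => //; rewrite ca0 scale0r !add0r.
have ca_gt0 : 0 < c a by rewrite lt_def ca0 c_ge0.
have caS : 0 < c a + S by rewrite ltr_wpDr.
exists ((c a / (c a + S)) *: p a + (1 - c a / (c a + S)) *: u).
  apply: cY => //; last exact: cp.
  rewrite divr_ge0 ?c_ge0 ?(ltW caS)//=.
  by rewrite ler_pdivrMr// mul1r lerDl.
rewrite scalerDr !scalerA; congr (_ *: _ + _ *: _); first by field; lra.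
by field; lra.
Qed.

(** Partial sums of weights of any sign may vanish, so the induction does not
    renormalize them: the affine set is a translate by u0 of a linear subspace,
    and one adds the vectors c a *: (p a - u0) one at a time. *)
Lemma affine_set_sum Y (I : Type) (r : seq I) (c0 : R) u0 (c : I -> R)
    (p : I -> 'rV[R]_e) :
  affine_set Y -> Y u0 -> (forall a, c a != 0 -> Y (p a)) ->
  c0 + \sum_(a <- r) c a = 1 ->
  Y (c0 *: u0 + \sum_(a <- r) c a *: p a).
Proof.
move=> aY Yu0 cp /(canRL (addrK _)) ->.
rewrite (_ : _ + _ = u0 + \sum_(a <- r) c a *: (p a - u0)); last first.
  under [in RHS]eq_bigr do rewrite scalerBr.
  rewrite scalerBl scale1r sumrB scaler_suml.
  by rewrite addrAC addrA.
elim: r => [|a r IH]; first by rewrite big_nil addr0.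
rewrite big_cons addrCA; set u := u0 + _ in IH *.
have [->|ca0] := eqVneq (c a) 0; first by rewrite scale0r add0r.
(* The sum u + c a *: (p a - u0) is the midpoint of two points that lie on
   lines through u0, one through p a and one through u. *)
have Y1 := aY _ _ (2 * c a) Yu0 (cp _ ca0).
have Y2 := aY _ _ 2 Yu0 IH.
suff -> : c a *: (p a - u0) + u =
    (1 - 2^-1) *: ((1 - 2 * c a) *: u0 + (2 * c a) *: p a)
    + 2^-1 *: ((1 - 2) *: u0 + 2 *: u) by exact: aY.
by apply/rowP => j; rewrite !mxE; field.
Qed.

Lemma convex_hull_sub_affine Y : convex_hull Y `<=` affine_hull Y.
Proof.
apply: convex_hull_min; last exact: sub_affine_hull.
exact: affine_convex (@affine_hull_affine Y).
Qed.

Lemma affine_hull_convex_hull Y : affine_hull (convex_hull Y) = affine_hull Y.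
Proof.
apply/seteqP; split; (apply: affine_hull_min; first exact: affine_hull_affine).
  exact: convex_hull_sub_affine.
by move=> u /sub_convex_hull; exact: sub_affine_hull.
Qed.

Definition affine_val (h : 'rV[R]_e * R) v : R := dotr h.1 v + h.2.

Lemma dotrDr (a : 'rV[R]_e) u v : dotr a (u + v) = dotr a u + dotr a v.
Proof.
by rewrite /dotr -big_split/=; apply: eq_bigr => i _; rewrite mxE mulrDr.
Qed.

Lemma dotrZr (a : 'rV[R]_e) (t : R) v : dotr a (t *: v) = t * dotr a v.
Proof. by rewrite /dotr mulr_sumr; apply: eq_bigr => i _; rewrite mxE mulrCA. Qed.

Lemma dotrDl (a b : 'rV[R]_e) v : dotr (a + b) v = dotr a v + dotr b v.
Proof.
by rewrite /dotr -big_split/=; apply: eq_bigr => i _; rewrite mxE mulrDl.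
Qed.

Lemma dotrNl (a : 'rV[R]_e) v : dotr (- a) v = - dotr a v.
Proof. by rewrite /dotr -sumrN; apply: eq_bigr => i _; rewrite mxE mulNr. Qed.

Lemma dotr_mulmx (a : 'rV[R]_e) v : v *m a^T = (dotr a v)%:M.
Proof.
apply/rowP => j; rewrite !mxE !ord1 eqxx mulr1n.
by apply: eq_bigr => i _; rewrite mxE mulrC.
Qed.

Lemma dotr_gt0 (a : 'rV[R]_e) : a != 0 -> 0 < dotr a a.
Proof.
move=> a0; have [i ai] : exists i, a 0 i != 0.
  apply/existsP; apply: contraNT a0; rewrite negb_exists => /forallP a0.
  by apply/eqP/rowP => i; rewrite mxE; apply/eqP; rewrite -[_ == _]negbK.
rewrite /dotr (bigD1 i)//= ltr_pwDl//; last first.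
  by rewrite sumr_ge0// => j _; rewrite -expr2 sqr_ge0.
by rewrite -expr2 lt_def sqrf_eq0 ai sqr_ge0.
Qed.

Lemma affine_val_conv h u v (t : R) :
  affine_val h (t *: u + (1 - t) *: v) = t * affine_val h u + (1 - t) * affine_val h v.
Proof. by rewrite /affine_val dotrDr !dotrZr; ring. Qed.

Lemma affine_hyperplane h : affine_set [set v | affine_val h v = 0].
Proof.
move=> u v t /= hu hv.
have := affine_val_conv h v u t; rewrite addrC hu hv => ->; ring.
Qed.

Lemma hull_affine_val_ge0 h Y : (forall p, Y p -> 0 <= affine_val h p) ->
  forall v, convex_hull Y v -> 0 <= affine_val h v.
Proof.
move=> hY; apply: convex_hull_min => //; apply/convex_setP => u v t t01 /= hu hv.
by rewrite affine_val_conv; nra.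
Qed.

(** The set of v with h v >= 0 that belong to the right-hand side as soon as
    h v = 0 is convex: on a segment between two points where h >= 0, an interior
    zero of h forces h to vanish at both ends. *)
Lemma convex_hull_face h Y : (forall p, Y p -> 0 <= affine_val h p) ->
  convex_hull Y `&` [set v | affine_val h v = 0] =
  convex_hull (Y `&` [set v | affine_val h v = 0]).
Proof.
move=> hY; apply/seteqP; split; last first.
  apply: convex_hull_min.
    apply/convex_setP => u v t t01 [uY /= hu] [vY hv]; split.
      by have /convex_setP cY := @convex_hull_convex Y; exact: cY.
    by rewrite /= affine_val_conv hu hv; ring.
  by move=> u [Yu hu]; split=> //; exact: sub_convex_hull.
move=> v [Yv /=]; apply: (proj2 (A := 0 <= affine_val h v)); move: v Yv.
apply: convex_hull_min; last first.
  by move=> p Yp /=; split; [exact: hY|move=> hp; exact: sub_convex_hull].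
apply/convex_setP => u v t /andP[t0 t1] /= [hu Zu] [hv Zv].
rewrite affine_val_conv; split; first by nra.
move=> uv0.
have [t00|tn0] := eqVneq t 0.
  move: uv0; rewrite t00 subr0 !(mul0r, scale0r, add0r, mul1r, scale1r).
  exact: Zv.
have [t10|tn1] := eqVneq t 1.
  move: uv0; rewrite t10 subrr !(mul0r, scale0r, addr0, mul1r, scale1r).
  exact: Zu.
have {tn0 t0}t0 : 0 < t by rewrite lt_def tn0.
have {tn1 t1}t1 : t < 1 by rewrite lt_def eq_sym tn1.
have /convex_setP cZ :=
  @convex_hull_convex (Y `&` [set v | affine_val h v = 0]).
by apply: cZ; [rewrite !ltW|apply: Zu; nra|apply: Zv; nra].
Qed.

Lemma convex_hull1 v : convex_hull [set v] = [set v].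
Proof.
apply/smallest_id/convex_setP => _ _ t _ /= -> ->.
by rewrite -scalerDl addrC subrK scale1r.
Qed.

Lemma convex_hull0 : convex_hull (@set0 'rV[R]_e) = set0.
Proof. by apply/smallest_id/convex_setP. Qed.

Lemma affine_hull0 : affine_hull (@set0 'rV[R]_e) = set0.
Proof. by apply/smallest_id. Qed.

Lemma rank_kermx_dotr (a : 'rV[R]_e) : a != 0 -> \rank (kermx a^T) = e.-1.
Proof. by move=> a0; rewrite mxrank_ker mxrank_tr rank_rV a0 subn1. Qed.

Lemma hyperplane_nonempty h : h.1 != 0 -> exists v, affine_val h v = 0.
Proof.
move=> /dotr_gt0 h0; exists (- (h.2 / dotr h.1 h.1) *: h.1).
by rewrite /affine_val dotrZr; field; rewrite gt_eqF.
Qed.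

Lemma sub_kermx_dotr (a : 'rV[R]_e) v :
  (v <= kermx a^T)%MS = (dotr a v == 0).
Proof.
rewrite sub_kermx dotr_mulmx; apply/eqP/eqP => [/matrixP/(_ 0 0)|->].
  by rewrite !mxE eqxx mulr1n.
exact: raddf0.
Qed.

Lemma affine_valB h u v : dotr h.1 (u - v) = affine_val h u - affine_val h v.
Proof. by rewrite /affine_val -scaleN1r dotrDr dotrZr; ring. Qed.

Lemma has_dim_hyperplane F h : h.1 != 0 ->
  affine_hull F = [set v | affine_val h v = 0] -> has_dim F e.-1.
Proof.
move=> h0 Fh; have [v hv] := hyperplane_nonempty h0.
exists v, (kermx h.1^T); split; first exact: rank_kermx_dotr.
rewrite Fh; apply/seteqP; split=> u /=; rewrite sub_kermx_dotr affine_valB hv subr0.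
  by move=> ->.
by move/eqP.
Qed.

Lemma has_dim_full F : affine_hull F = setT -> has_dim F e.
Proof.
move=> FT; exists 0, 1%:M; split; first exact: mxrank1.
by rewrite FT; apply/seteqP; split=> // u _ /=; exact: submx1.
Qed.

Lemma has_dim_full_uniq F k : affine_hull F = setT -> has_dim F k -> k = e.
Proof.
move=> FT [v [V [<-]]]; rewrite FT => VT.
apply/eqP; rewrite eqn_leq rank_leq_col/=.
rewrite -[leqLHS](mxrank1 R); apply: mxrankS; apply/row_subP => i.
have : [set: 'rV[R]_e] (v + row i 1%:M) by [].
by rewrite VT /= addrC addKr.
Qed.

(** A set of codimension one inside a hyperplane spans it: its direction space
    is contained in the kernel of the normal and has the same rank. *)
Lemma has_dim_sub_hyperplane F h k : h.1 != 0 ->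
  F `<=` [set v | affine_val h v = 0] -> has_dim F k -> k.+1 = e ->
  affine_hull F = [set v | affine_val h v = 0].
Proof.
move=> h0 Fh [v [V [rV FV]]] ke.
have Fh' : affine_hull F `<=` [set v | affine_val h v = 0].
  by apply: affine_hull_min => //; exact: affine_hyperplane.
have hv : affine_val h v = 0 by apply: Fh'; rewrite FV /= subrr sub0mx.
have Vker : (V <= kermx h.1^T)%MS.
  apply/row_subP => i; rewrite sub_kermx_dotr.
  have -> : row i V = (row i V + v) - v by rewrite addrK.
  rewrite affine_valB hv subr0; apply/eqP/Fh'.
  by rewrite FV /= addrK row_sub.
have kerV : (kermx h.1^T <= V)%MS.
  rewrite -(mxrank_leqif_sup Vker) rV rank_kermx_dotr//.
  by rewrite -ke.
apply/seteqP; split=> // u /= hu.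
rewrite FV /=; apply: submx_trans kerV.
by rewrite sub_kermx_dotr affine_valB hu hv subrr.
Qed.

Implicit Types (L : seq ('rV[R]_e * R)).

(** Averaging points of F, each off one of the hyperplanes, gives a point off
    all of them, since no inequality can be violated inside F. *)
Lemma exists_off_hyperplanes F L : convex_set F -> F !=set0 ->
  (forall h, h \in L -> forall v, F v -> 0 <= affine_val h v) ->
  (forall h, h \in L -> exists2 u, F u & affine_val h u != 0) ->
  exists2 w, F w & forall h, h \in L -> 0 < affine_val h w.
Proof.
move=> /convex_setP cF [v0 Fv0]; elim: L => [|h L IH] F_ge0 F_n0.
  by exists v0.
have [h' h'L|h' h'L|w Fw w_gt0] := IH.
- by apply: F_ge0; rewrite inE h'L orbT.
- by apply: F_n0; rewrite inE h'L orbT.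
have [u Fu hu] := F_n0 h (mem_head _ _).
exists (2^-1 *: u + (1 - 2^-1) *: w) => [|h'].
  by apply: cF => //; apply/andP; split; lra.
rewrite affine_val_conv inE => /orP[/eqP->|h'L].
  have : 0 < affine_val h u by rewrite lt_def hu F_ge0// mem_head.
  have : 0 <= affine_val h w by rewrite F_ge0// mem_head.
  lra.
have : 0 <= affine_val h' u by rewrite F_ge0// inE h'L orbT.
by have := w_gt0 _ h'L; lra.
Qed.

Lemma exists_small_step L w (a : 'rV[R]_e) :
  (forall h, h \in L -> 0 < affine_val h w) ->
  exists2 r : R, 0 < r & forall t, 0 <= t <= r ->
    forall h, h \in L -> 0 <= affine_val h (w + t *: a).
Proof.
elim: L => [|h L IH] w_gt0; first by exists 1.
have [h' h'L|r r0 rP] := IH; first by apply: w_gt0; rewrite inE h'L orbT.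
have hw := w_gt0 h (mem_head _ _).
set d := dotr h.1 a; have d0 : 0 <= `|d| by exact: normr_ge0.
exists (Num.min r (affine_val h w / (1 + `|d|))).
  by rewrite lt_min r0 divr_gt0//; lra.
move=> t /andP[t0]; rewrite le_min => /andP[tr td] h'.
rewrite inE => /orP[/eqP->|]; last by apply: rP; rewrite t0.
have -> : affine_val h (w + t *: a) = affine_val h w + t * d.
  by rewrite /affine_val dotrDr dotrZr -/d; ring.
move: td; rewrite ler_pdivlMr; last by lra.
have : - d <= `|d| by rewrite -normrN ler_norm.
by nra.
Qed.

Lemma is_face_convex P F : convex_set P -> is_face P F -> convex_set F.
Proof.
move=> /convex_setP cP [a [b [Pab ->]]]; apply/convex_setP => u v t t01.
move=> [Pu /= ua] [Pv /= va]; split; first exact: cP.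
by rewrite /= dotrDr !dotrZr ua va; ring.
Qed.

(** ** Reading the facets off a system of inequalities *)

Section FacetCriterion.
Variables (Y : set 'rV[R]_e) (L : seq ('rV[R]_e * R)).
Let P := convex_hull Y.
Hypothesis L_valid : forall h p, h \in L -> Y p -> 0 <= affine_val h p.
Hypothesis L_complete : forall v, (forall h, h \in L -> 0 <= affine_val h v) -> P v.
Hypothesis L_neq0 : forall h, h \in L -> h.1 != 0.
Hypothesis L_span : forall h, h \in L ->
  [set v | affine_val h v = 0] `<=` affine_hull (Y `&` [set v | affine_val h v = 0]).
Hypothesis Y_span : affine_hull Y = setT.

Lemma affine_hull_facet h : h \in L ->
  affine_hull (convex_hull (Y `&` [set v | affine_val h v = 0])) =
  [set v | affine_val h v = 0].
Proof.
move=> hL; rewrite affine_hull_convex_hull; apply/seteqP; split.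
  by apply: affine_hull_min; [exact: affine_hyperplane|move=> v []].
exact: L_span.
Qed.

Lemma hull_valid h : h \in L -> forall v, P v -> 0 <= affine_val h v.
Proof. by move=> hL; apply: hull_affine_val_ge0 => p; exact: L_valid. Qed.

(** Otherwise F contains a point w strictly inside all the half-spaces. Moving
    from w a little along the outer normal a stays in P, which contradicts the
    maximality of a on F unless a = 0; but then F = P is full-dimensional. *)
Lemma facet_sub_hyperplane F a b k :
  (forall v, P v -> dotr a v <= b) -> F = P `&` [set v | dotr a v = b] ->
  has_dim F k -> (k < e)%N -> F !=set0 ->
  exists2 h, h \in L & F `<=` [set v | affine_val h v = 0].
Proof.
move=> Pab FE Fk ke F0; apply: contrapT => Fn.
have faceF : is_face P F by exists a, b.
have [|h hL v|h hL|w Fw w_gt0] := @exists_off_hyperplanes F L _ F0.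
- exact: is_face_convex (@convex_hull_convex Y) faceF.
- by rewrite FE => -[Pv _]; exact: hull_valid.
- apply: contrapT => Fh; apply: Fn; exists h => // u Fu /=.
  by apply/eqP; apply: contrapT => /negP hu; apply: Fh; exists u.
have [r r0 rP] := exists_small_step a w_gt0.
have [a0|a0] := eqVneq a 0.
  suff FP : F = P.
    have := has_dim_full_uniq _ Fk; rewrite FP affine_hull_convex_hull Y_span.
    by move=> /(_ erefl) ke'; rewrite ke' ltnn in ke.
  have dot0 v : dotr a v = 0.
    by rewrite a0 /dotr big1// => i _; rewrite mxE mul0r.
  have b0 : b = 0 by move: Fw; rewrite FE => -[_ /= <-].
  by rewrite FE; apply/seteqP; split=> [v []//|v Pv]; split=> //=; rewrite dot0.
have := Pab (w + r *: a) (L_complete (rP r _)); rewrite lexx ltW// => /(_ isT).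
move: Fw; rewrite FE => -[_ /= wb]; rewrite dotrDr dotrZr wb gerDl leNgt.
by rewrite mulr_gt0// dotr_gt0.
Qed.

(** A facet F is contained in one of the hyperplanes by facet_sub_hyperplane,
    hence spans it for reasons of dimension. Its own supporting hyperplane then
    contains that hyperplane, so F is all of the corresponding face. *)
Lemma is_facet_hull_zero_set F : is_facet P F <->
  exists2 h, h \in L & F = convex_hull (Y `&` [set v | affine_val h v = 0]).
Proof.
have PT : affine_hull P = setT by rewrite affine_hull_convex_hull.
split=> [[[a [b [Pab FE]]] [k Pk Fk]]|[h hL ->]]; last first.
  have Fh := convex_hull_face (fun p => @L_valid h p hL).
  split.
    exists (- h.1), h.2; split=> [v Pv|].
      by have := hull_valid hL Pv; rewrite /affine_val dotrNl; lra.
    rewrite -Fh; congr (_ `&` _); apply/seteqP; split=> v /=;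
      by rewrite /affine_val dotrNl; lra.
  have e0 : (0 < e)%N.
    rewrite lt0n; apply: contraNneq (L_neq0 hL) => e0.
    by apply/eqP/rowP => -[i ie]; exfalso; move: (ie); rewrite e0.
  exists e.-1; first by rewrite prednK//; exact: has_dim_full.
  exact: has_dim_hyperplane (L_neq0 hL) (affine_hull_facet hL).
have ke : k.+1 = e by exact: has_dim_full_uniq Pk.
have F0 : F !=set0.
  apply/set0P/eqP => F0; have [v [V [_]]] := Fk.
  rewrite F0 affine_hull0 => /seteqP[_ /(_ v)]; apply.
  by rewrite /= subrr sub0mx.
have [h hL Fh] := facet_sub_hyperplane Pab FE Fk (eq_leq ke) F0.
exists h => //; rewrite -convex_hull_face; last by move=> p; exact: L_valid.
have aF := has_dim_sub_hyperplane (L_neq0 hL) Fh Fk ke.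
apply/seteqP; split=> v; first by move=> Fv; split; [move: Fv; rewrite FE => -[]|exact: Fh].
move=> [Pv hv]; rewrite FE; split=> //.
have : affine_hull F `<=` [set v | affine_val (a, - b) v = 0].
  apply: affine_hull_min; first exact: affine_hyperplane.
  by move=> u; rewrite FE /affine_val/= => -[_ ->]; rewrite subrr.
by rewrite aF => /(_ v hv); rewrite /affine_val/= => /eqP; rewrite subr_eq0 => /eqP.
Qed.

(** The sum of the inequalities that are tight at p vanishes, among the points of
    Y, at p only, so it exposes p. *)
Lemma vertices_convex_hull :
  (forall p q, Y p -> Y q -> q != p ->
    exists h, [/\ h \in L, affine_val h p = 0 & affine_val h q != 0]) ->
  vertices P = Y.
Proof.
move=> sepY; apply/seteqP; split=> p.
  move=> [a [b [Pab pE]]].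
  have abE v : affine_val (- a, b) v = b - dotr a v by rewrite /affine_val dotrNl addrC.
  have Pface : P `&` [set v | affine_val (- a, b) v = 0] =
      convex_hull (Y `&` [set v | affine_val (- a, b) v = 0]).
    apply: convex_hull_face => q Yq; rewrite abE subr_ge0.
    by apply: Pab; exact: sub_convex_hull.
  have {}pE : [set p] = P `&` [set v | affine_val (- a, b) v = 0].
    rewrite pE; congr (_ `&` _); apply/seteqP; split=> v /=; rewrite abE; lra.
  have [q [Yq hq]] : (Y `&` [set v | affine_val (- a, b) v = 0]) !=set0.
    apply/set0P/eqP => Y0; move: Pface; rewrite Y0 convex_hull0 -pE.
    by move=> /seteqP[/(_ p) + _]; apply.
  have : [set p] q by rewrite pE; split=> //; exact: sub_convex_hull.
  by move=> <-.
move=> Yp.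
pose Lp := [seq h <- L | affine_val h p == 0].
have [g gE] : exists g, forall v, affine_val g v = \sum_(h <- Lp) affine_val h v.
  exists (\sum_(h <- Lp) h.1, \sum_(h <- Lp) h.2) => v.
  rewrite /affine_val/=; elim: Lp => [|h s IH].
    by rewrite !big_nil addr0 /dotr big1// => i _; rewrite mxE mul0r.
  by rewrite !big_cons dotrDl -IH; ring.
have LpP h : h \in Lp -> h \in L /\ affine_val h p = 0.
  by rewrite mem_filter => /andP[/eqP].
have g_ge0 q : Y q -> 0 <= affine_val g q.
  by move=> Yq; rewrite gE big_seq sumr_ge0// => h /LpP[hL _]; exact: L_valid.
exists (- g.1), g.2; split=> [v Pv|].
  by have := hull_affine_val_ge0 g_ge0 Pv; rewrite /affine_val dotrNl; lra.
transitivity (P `&` [set v | affine_val g v = 0]); last first.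
  congr (_ `&` _); apply/seteqP; split=> v /=; by rewrite /affine_val dotrNl; lra.
rewrite convex_hull_face//.
suff -> : Y `&` [set v | affine_val g v = 0] = [set p] by rewrite convex_hull1.
apply/seteqP; split=> q /=; last first.
  by move=> ->; split=> //; rewrite gE big_seq big1// => h /LpP[].
move=> [Yq gq]; apply/eqP; apply: contraPT gq => qp; rewrite gE.
have [h [hL hp hq]] := sepY p q Yp Yq qp.
have hLp : h \in Lp by rewrite mem_filter hp eqxx.
apply/eqP; rewrite gt_eqF// (big_rem h)//= ltr_pwDl//.
  by rewrite lt_def hq L_valid.
rewrite big_seq sumr_ge0// => h' /mem_rem/LpP[h'L _]; exact: L_valid.
Qed.
End FacetCriterion.

End Hulls.

(** * Sequences with a linear recurrence *)

Lemma sign_change (R : realDomainType) (g : nat -> R) a b : (a < b)%N ->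
  0 <= g a -> g b <= 0 -> exists2 i, (a <= i < b)%N & g i.+1 <= 0 <= g i.
Proof.
elim: b => [//|b IH]; rewrite ltnS leq_eqVlt => /orP[/eqP<-|ab] ga gb.
  by exists a; rewrite ?leqnn ?ltnSn// gb.
have [gb0|/ltW gb0] := lerP 0 (g b).
  by exists b; rewrite ?gb// ltnW//= ltnSn.
by have [i /andP[ai ib] gi] := IH ab ga gb0; exists i; rewrite // ai ltnW.
Qed.

Section Realization.
Context {R : realType} (D : nat).
Hypothesis D1 : (1 < D)%N.
Let D0 : (0 < D)%N := ltnW D1.
Implicit Types (x y w : nat -> R) (lam : R) (i j k m : nat) (v : 'rV[R]_D.+1).

(** With the equation read backwards, x m is given by the same formula in terms of
    the D + 1 next values: the recurrence is invariant under reversal. *)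
Definition solves lam x := forall m,
  x (m + D.+1)%N = 2 * x (m + D)%N + 2 * x m.+1 - x m + lam.

(** A window is a function of which only the values at 0, ..., D matter; the
    solution is computed by sliding it. *)
Definition shift_window lam w : nat -> R := fun k =>
  if (k < D)%N then w k.+1 else 2 * w D + 2 * w 1%N - w 0%N + lam.

Definition solution lam w m : R := iter m (shift_window lam) w 0%N.

Lemma iter_shift_window lam w m k : (k <= D)%N ->
  iter m (shift_window lam) w k = solution lam w (m + k).
Proof.
elim: k m => [|k IH] m kD; first by rewrite addn0.
by rewrite addnS -addSn -IH ?(ltnW kD)// iterS /shift_window kD.
Qed.

Lemma solution_init lam w k : (k <= D)%N -> solution lam w k = w k.
Proof. by move=> kD; rewrite -[k]add0n -iter_shift_window. Qed.

Lemma solutionP lam w : solves lam (solution lam w).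
Proof.
move=> m; rewrite -[(m + D.+1)%N]addSnnS -iter_shift_window//= {1}/shift_window ltnn.
by rewrite !iter_shift_window// addn1 addn0.
Qed.

Lemma solvesB lam1 lam2 x y : solves lam1 x -> solves lam2 y ->
  solves (lam1 - lam2) (fun m => x m - y m).
Proof. by move=> xP yP m; rewrite xP yP; ring. Qed.

Lemma solvesN x : solves 0 x -> solves 0 (fun m => - x m).
Proof. by move=> xP m; rewrite xP; ring. Qed.

Lemma solves_lincomb I (r : seq I) (c : I -> R) (x : I -> nat -> R) (lam : R) y :
  (forall a, solves 0 (x a)) -> solves lam y ->
  solves lam (fun m => \sum_(a <- r) c a * x a m + y m).
Proof.
move=> xP yP; elim: r => [|a r IH] m; first by rewrite !big_nil !add0r.
by rewrite !big_cons -!addrA IH xP; ring.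
Qed.

Lemma solves_window_down x i : solves 0 x ->
  (forall k, (k <= D)%N -> x (i + k)%N = 0) ->
  forall k, (k <= D)%N -> x k = 0.
Proof.
move=> xP; elim: i => [//|i IH] x0; apply: IH => -[_|k kD]; last first.
  by rewrite addnS -addSn x0// ltnW.
have xi1 : x i.+1 = 0 by rewrite -[i.+1]addn0 x0.
have xiD : x (i + D)%N = 0 by rewrite -(prednK D0) addnS -addSn x0// leq_pred.
have := xP i; rewrite addnS -addSn x0// xi1 xiD addn0; lra.
Qed.

(** Any D + 1 consecutive values determine a solution, because the recurrence can
    be run in both directions. *)
Lemma solves_eq lam x y i : solves lam x -> solves lam y ->
  (forall k, (k <= D)%N -> x (i + k)%N = y (i + k)%N) -> x =1 y.
Proof.
move=> xP yP xy; pose z m := x m - y m.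
have zP : solves 0 z by rewrite -[0](subrr lam); exact: solvesB.
have z0 : forall k, (k <= D)%N -> z k = 0.
  by apply: (solves_window_down (i := i)) => // k kD; rewrite /z xy// subrr.
suff z00 m : forall k, (k <= D)%N -> z (m + k)%N = 0.
  move=> m; apply/eqP; rewrite -subr_eq0 -/(z m).
  by rewrite -[m]addn0 z00.
elim: m => [//|m IH] k; rewrite leq_eqVlt => /orP[/eqP->|kD]; last first.
  by rewrite addSnnS IH.
rewrite addSnnS zP IH//.
have -> : z m.+1 = 0 by rewrite -addn1 IH.
have -> : z m = 0 by rewrite -[m]addn0 IH.
by ring.
Qed.

(** If x p and x (p + 1) are nonnegative and increasing then
    2 x (p + 1) - x p >= 0, whence x (p + D + 1) >= 2 x (p + D). *)
Lemma solves_le_succ lam x a : 0 <= lam -> solves lam x ->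
  (forall k, (a <= k < a + D)%N -> 0 <= x k <= x k.+1) ->
  forall k, (a <= k)%N -> 0 <= x k <= x k.+1.
Proof.
move=> lam0 xP x0; elim/ltn_ind => k IH ak.
have [kD|kD] := ltnP k (a + D); first by rewrite x0// ak.
have [p pE ap] : exists2 p, k = (p + D)%N & (a <= p)%N.
  by exists (k - D)%N; lia.
have /andP[p0 pS] : 0 <= x p <= x p.+1 by apply: IH; lia.
have /andP[k0 kS] : 0 <= x k.-1 <= x k by rewrite -{3}(@prednK k) ?IH//; lia.
by rewrite pE -addnS xP -pE; lra.
Qed.

Lemma solves_le lam x a : 0 <= lam -> solves lam x ->
  (forall k, (a <= k < a + D)%N -> 0 <= x k <= x k.+1) ->
  forall k l, (a <= k <= l)%N -> x k <= x l.
Proof.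
move=> lam0 xP x0 k + /andP[ak]; elim=> [|l IH].
  by rewrite leqn0 => /eqP->.
rewrite leq_eqVlt => /orP[/eqP->//|kl].
apply: le_trans (IH kl) _.
by have /andP[] := solves_le_succ lam0 xP x0 (leq_trans ak kl).
Qed.

(** One half of each of the three kinds of sequences; the other half is its
    reflection. The value 2 in baseE is forced by the recurrence on the
    window that starts one step before 0, where the value at -1 is 0 = baseE 1. *)
Definition baseT := solution 1 (fun=> 0).
Definition baseG := solution 0 (fun k => (k == D)%:R).
Definition baseE := solution 0 (fun k => (k == 0%N)%:R + 2 * (k == D)%:R).

Lemma baseT_eq0 k : (k <= D)%N -> baseT k = 0.
Proof. by move=> kD; rewrite /baseT solution_init. Qed.

Lemma baseT_gt0 k : (D < k)%N -> 0 < baseT k.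
Proof.
move=> Dk; have baseT_sol : solves 1 baseT by exact: solutionP.
apply: lt_le_trans (_ : baseT D.+1 <= _).
  by rewrite -[D.+1]add0n baseT_sol !baseT_eq0//; lra.
apply: (@solves_le 1 baseT 0); rewrite ?ler01// => l /andP[_ lD].
by rewrite !baseT_eq0 ?lexx// ltnW.
Qed.

Lemma baseG_eq0 k : (k < D)%N -> baseG k = 0.
Proof. by move=> kD; rewrite /baseG solution_init ?(ltnW kD)// ltn_eqF. Qed.

Lemma baseG_at_D : baseG D = 1.
Proof. by rewrite /baseG solution_init// eqxx. Qed.

Lemma baseG_gt0 k : (D <= k)%N -> 0 < baseG k.
Proof.
move=> Dk; have baseG_sol : solves 0 baseG by exact: solutionP.
apply: lt_le_trans (_ : baseG D <= _); first by rewrite baseG_at_D.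
apply: (@solves_le 0 baseG 0) => // l /andP[_ lD].
rewrite baseG_eq0// lexx/=; move: lD; rewrite add0n leq_eqVlt => /orP[/eqP->|lD].
  by rewrite baseG_at_D.
by rewrite baseG_eq0.
Qed.

Lemma baseE_at_0 : baseE 0 = 1.
Proof. by rewrite /baseE solution_init// eqxx ltn_eqF// mulr0 addr0. Qed.

Lemma baseE_eq0 k : (0 < k < D)%N -> baseE k = 0.
Proof.
move=> /andP[k0 kD]; rewrite /baseE solution_init ?(ltnW kD)// (ltn_eqF kD).
by rewrite gtn_eqF// mulr0 addr0.
Qed.

Lemma baseE_at_D : baseE D = 2.
Proof. by rewrite /baseE solution_init// eqxx gtn_eqF// mulr1 add0r. Qed.

Lemma baseE_gt0 k : (D <= k)%N -> 0 < baseE k.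
Proof.
move=> Dk; have baseE_sol : solves 0 baseE by exact: solutionP.
apply: lt_le_trans (_ : baseE D <= _); first by rewrite baseE_at_D.
apply: (@solves_le 0 baseE 1) => //; last by rewrite D0.
move=> l /andP[l0]; rewrite add1n ltnS leq_eqVlt => /orP[/eqP->|lD].
  rewrite baseE_at_D -[D.+1]add0n baseE_sol add0n baseE_at_D baseE_at_0 baseE_eq0//; lra.
rewrite [baseE l]baseE_eq0 ?l0// lexx/=.
have [/eqP->|lD'] := boolP (l.+1 == D); first by rewrite baseE_at_D.
by rewrite baseE_eq0//; lia.
Qed.

(** With truncated subtraction at most one of the two terms in seqT and in seqG is
    nonzero, and the argument of baseE in seqE is the distance from m to j. *)
Definition seqT i m := baseT (m - i) + baseT (i + D - m).
Definition seqG i m := baseG (m - i) - baseG (i + D - 1 - m).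
Definition seqE j m := baseE ((m - j) + (j - m)).

Lemma seqT_solves i : solves 1 (seqT i).
Proof.
move=> m; have baseT_sol : solves 1 baseT by exact: solutionP.
rewrite /seqT; have [im|mi] := leqP i m.
  rewrite -!addSnnS !(@baseT_eq0 (i + D - _)); try lia.
  have := baseT_sol (m - i)%N; rewrite addnS.
  have -> : (m.+1 + D - i)%N = ((m - i) + D).+1 by lia.
  have -> : (m + D - i)%N = (m - i + D)%N by lia.
  have -> : (m.+1 - i)%N = (m - i).+1 by lia.
  lra.
rewrite !(@baseT_eq0 (_ - i)); try lia.
have := baseT_sol (i - m).-1; rewrite addnS.
have -> : (i + D - (m + D.+1))%N = (i - m).-1 by lia.
have -> : (i + D - (m + D))%N = ((i - m).-1).+1 by lia.
have -> : (i + D - m)%N = ((i - m).-1 + D).+1 by lia.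
have -> : (i + D - m.+1)%N = ((i - m).-1 + D)%N by lia.
lra.
Qed.

Lemma seqG_solves i : solves 0 (seqG i).
Proof.
move=> m; have baseG_sol : solves 0 baseG by exact: solutionP.
rewrite /seqG; have [im|mi] := leqP i m.
  rewrite !(@baseG_eq0 (i + D - _ - _)); try lia.
  have := baseG_sol (m - i)%N.
  have -> : (m + D.+1 - i)%N = (m - i + D.+1)%N by lia.
  have -> : (m + D - i)%N = (m - i + D)%N by lia.
  have -> : (m.+1 - i)%N = (m - i).+1 by lia.
  lra.
have [im|im] := leqP i m.+1.
  have {mi im} -> : i = m.+1 by lia.
  have -> : (m + D.+1 - m.+1)%N = D by lia.
  have -> : (m.+1 + D - 1 - m)%N = D by lia.
  rewrite baseG_at_D !baseG_eq0; try lia; lra.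
rewrite !(@baseG_eq0 (_ - i)); try lia.
have := baseG_sol (i - m - 2)%N.
have -> : (i + D - 1 - (m + D.+1))%N = (i - m - 2)%N by lia.
have -> : (i + D - 1 - (m + D))%N = (i - m - 2).+1%N by lia.
have -> : (i + D - 1 - m.+1)%N = (i - m - 2 + D)%N by lia.
have -> : (i + D - 1 - m)%N = (i - m - 2 + D.+1)%N by lia.
lra.
Qed.

Lemma seqE_solves j : solves 0 (seqE j).
Proof.
move=> m; have baseE_sol : solves 0 baseE by exact: solutionP.
rewrite /seqE; have [jm|mj] := leqP j m.
  have := baseE_sol (m - j)%N.
  have -> : (m + D.+1 - j + (j - (m + D.+1)))%N = (m - j + D.+1)%N by lia.
  have -> : (m + D - j + (j - (m + D)))%N = (m - j + D)%N by lia.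
  have -> : (m.+1 - j + (j - m.+1))%N = (m - j).+1 by lia.
  have -> : (m - j + (j - m))%N = (m - j)%N by lia.
  lra.
have [jm|jm] := leqP (m + D.+1) j.
  have := baseE_sol (j - (m + D.+1))%N.
  have -> : (m + D.+1 - j + (j - (m + D.+1)))%N = (j - (m + D.+1))%N by lia.
  have -> : (m + D - j + (j - (m + D)))%N = (j - (m + D.+1)).+1%N by lia.
  have -> : (m.+1 - j + (j - m.+1))%N = (j - (m + D.+1) + D)%N by lia.
  have -> : (m - j + (j - m))%N = (j - (m + D.+1) + D.+1)%N by lia.
  lra.
have [jm1|jm1] := eqVneq j m.+1.
  rewrite jm1.
  have -> : (m + D.+1 - m.+1 + (m.+1 - (m + D.+1)))%N = D by lia.
  have -> : (m.+1 - m.+1 + (m.+1 - m.+1))%N = 0%N by lia.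
  by rewrite baseE_at_D baseE_at_0 !baseE_eq0; [lra|lia|lia].
have [jm2|jm2] := eqVneq j (m + D)%N.
  rewrite jm2.
  have -> : (m + D - (m + D) + (m + D - (m + D)))%N = 0%N by lia.
  have -> : (m - (m + D) + (m + D - m))%N = D by lia.
  by rewrite baseE_at_D baseE_at_0 !baseE_eq0; [lra|lia|lia].
by rewrite !baseE_eq0; [lra|lia|lia|lia|lia].
Qed.

(** * The points and the barycentric coordinates *)

(** The sequences with constant 0 and unit windows at 0, ..., D. *)
Definition fundamental m : 'rV[R]_D.+1 :=
  \row_j solution 0 (fun k => (k == j)%:R) m.

(** Dividing by baseT makes the sequence baseT correspond to the constant affine
    function 1. Since baseT vanishes at D, point 0 is the zero vector, whatever
    fundamental D is; it is the point at which the constant lam is evaluated. *)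
Definition point k : 'rV[R]_D.+1 := (baseT (k + D))^-1 *: fundamental (k + D).

(** The affine function attached to a solution x with constant lam, in coordinates
    given by the window at 0 (see functional_point0 and functional_point). *)
Definition functional x lam : 'rV[R]_D.+1 * R := (\row_j x j, lam).

Lemma solves_baseT : solves 1 baseT.
Proof. exact: solutionP. Qed.

Lemma solvesZ lam x (c : R) : solves lam x -> solves (c * lam) (fun m => c * x m).
Proof. by move=> xP m; rewrite xP; ring. Qed.

Lemma functionalE x lam v : affine_val (functional x lam) v = \sum_(j < D.+1) x j * v 0 j + lam.
Proof. by congr (_ + _); apply: eq_bigr => j _; rewrite mxE. Qed.

Lemma functionalN x v : affine_val (functional (fun m => - x m) 0) v = - affine_val (functional x 0) v.
Proof.
by rewrite !functionalE !addr0 -sumrN; apply: eq_bigr => j _; rewrite mulNr.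
Qed.

Lemma solves_fundamental lam x : solves lam x -> forall m,
  x m = \sum_(j < D.+1) x j * fundamental m 0 j + lam * baseT m.
Proof.
move=> xP; apply: (@solves_eq lam _ _ 0) => //.
  have := @solves_lincomb _ (index_enum _) (fun j : 'I_D.+1 => x j)
    (fun (j : 'I_D.+1) m => fundamental m 0 j) _ _ _ (solvesZ lam solves_baseT).
  rewrite mulr1; apply => j m; rewrite !mxE; exact: solutionP.
move=> k kD; rewrite add0n baseT_eq0// mulr0 addr0.
rewrite (bigD1 (inord k))//= mxE inordK// solution_init// eqxx mulr1.
rewrite big1 ?addr0// => j jk; rewrite mxE solution_init//.
case: eqP => [kj|]; last by rewrite mulr0.
by move: jk; rewrite kj inord_val eqxx.
Qed.

Lemma point0 : point 0 = 0.
Proof. by rewrite /point baseT_eq0// invr0 scale0r. Qed.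

Lemma functional_point0 x lam : affine_val (functional x lam) (point 0) = lam.
Proof. by rewrite functionalE point0 big1 ?add0r// => j _; rewrite mxE mulr0. Qed.

Lemma baseT_point_gt0 k : (0 < k)%N -> 0 < baseT (k + D).
Proof. by move=> k0; apply: baseT_gt0; rewrite -[D in (D < _)%N]add0n ltn_add2r. Qed.

Lemma functional_point x lam k : solves lam x -> (0 < k)%N ->
  affine_val (functional x lam) (point k) = x (k + D)%N / baseT (k + D).
Proof.
move=> xP k0; have t0 := baseT_point_gt0 k0.
rewrite (solves_fundamental xP) functionalE mulrDl mulfK ?gt_eqF// mulr_suml; congr (_ + _).
by apply: eq_bigr => j _; rewrite mxE mulrCA mulrC.
Qed.

(** The solutions with constant 0 and a unit window at i, ..., i + D. *)
Definition dual i k : nat -> R :=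
  if k == 0%N then fun m => - seqG i.+1 m else
  if k == D then seqG i else seqE (i + k).

Lemma solves_dual i k : solves 0 (dual i k).
Proof.
rewrite /dual; case: ifP => _; first by apply: solvesN; exact: seqG_solves.
by case: ifP => _; [exact: seqG_solves|exact: seqE_solves].
Qed.

Lemma dual_window i k l : (k <= D)%N -> (l <= D)%N ->
  dual i k (i + l) = (l == k)%:R.
Proof.
move=> kD lD; rewrite /dual /seqG /seqE.
have [->|k0] := eqVneq k 0%N.
  rewrite [in X in - (X - _)]baseG_eq0//; last by lia.
  have [->|l0] := eqVneq l 0%N; last by rewrite baseG_eq0// ?subrr ?oppr0//; lia.
  by rewrite (_ : (_ - _)%N = D) ?baseG_at_D ?opprB ?subr0//; lia.
have [->|kD'] := eqVneq k D.
  rewrite [in X in _ - X]baseG_eq0//; last by lia.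
  have [->|lD'] := eqVneq l D; last by rewrite baseG_eq0// ?subrr ?oppr0//; lia.
  by rewrite (_ : (_ - _)%N = D) ?baseG_at_D ?opprB ?subr0//; lia.
have [->|lk] := eqVneq l k.
  by rewrite (_ : (_ + _)%N = 0%N) ?baseE_at_0//; lia.
by rewrite baseE_eq0//; lia.
Qed.

(** The functions dual i k, together with seqT i for the constant, form a basis of
    the space of solutions, dual to the values in a window and the constant. *)
Lemma solves_window lam x i : solves lam x -> forall m,
  x m = \sum_(k < D.+1) x (i + k)%N * dual i k m + lam * seqT i m.
Proof.
move=> xP; apply: (@solves_eq lam _ _ i) => //.
  have := @solves_lincomb _ (index_enum _)
    (fun k : 'I_D.+1 => x (i + k)%N)
    (fun (k : 'I_D.+1) => dual i k) _ _ _ (solvesZ lam (seqT_solves i)).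
  by rewrite mulr1; apply => j; exact: solves_dual.
move=> l lD; rewrite /seqT !baseT_eq0; try lia.
rewrite addr0 mulr0 addr0 (bigD1 (inord l))//= inordK// dual_window// eqxx mulr1.
rewrite big1 ?addr0// => k kl; rewrite dual_window//; last by rewrite -ltnS.
case: eqP => [lk|]; last by rewrite mulr0.
by move: kl; rewrite lk inord_val eqxx.
Qed.

Lemma functional_window lam x i v : solves lam x ->
  affine_val (functional x lam) v =
    \sum_(k < D.+1) x (i + k)%N * affine_val (functional (dual i k) 0) v
    + lam * affine_val (functional (seqT i) 1) v.
Proof.
move=> xP; rewrite !functionalE mulrDr mulr1 addrA; congr (_ + _).
under [in RHS]eq_bigr do rewrite functionalE addr0 mulr_sumr.
rewrite exchange_big/= mulr_sumr -big_split/=; apply: eq_bigr => j _.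
rewrite (solves_window i xP) mulrDl mulr_suml -mulrA; congr (_ + _).
by apply: eq_bigr => k _; rewrite mulrA.
Qed.

(** Barycentric coordinates in the simplex on point 0 and
    point i, ..., point (i + D). The coordinate at point 0 is the
    functional of seqT; the factor baseT undoes the scaling in point. *)
Definition bary i v k := baseT (i + k + D) * affine_val (functional (dual (i + D) k) 0) v.

(** This is functional_window for baseT, whose functional is constantly 1. *)
Lemma sum_bary i v :
  affine_val (functional (seqT (i + D)) 1) v + \sum_(k < D.+1) bary i v k = 1.
Proof.
have := functional_window (i + D) v solves_baseT.
rewrite functionalE big1 ?add0r ?mul1r; last first.
  by move=> j _; rewrite baseT_eq0 ?mul0r// -ltnS.
move=> E; rewrite [RHS]E addrC; congr (_ + _).
by apply: eq_bigr => k _; rewrite /bary addnAC.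
Qed.

(** This is functional_window for the coordinate sequences in fundamental. *)
Lemma bary_decomposition i v : (0 < i)%N ->
  v = affine_val (functional (seqT (i + D)) 1) v *: point 0
      + \sum_(k < D.+1) bary i v k *: point (i + k).
Proof.
move=> i0; rewrite point0 scaler0 add0r; apply/rowP => j.
have fP : solves 0 (fun m => fundamental m 0 j).
  by move=> m; rewrite !mxE; exact: solutionP.
have := functional_window (i + D) v fP.
rewrite functionalE mul0r !addr0 (bigD1 j)//= big1 ?addr0; last first.
  move=> k kj; rewrite mxE solution_init; last by rewrite -ltnS.
  by rewrite (_ : _ == _ = false) ?mul0r//; exact: negbTE.
rewrite mxE solution_init; last by rewrite -ltnS.
rewrite eqxx mul1r => ->; rewrite summxE; apply: eq_bigr => k _.
have t0 : baseT (i + k + D) != 0 by rewrite gt_eqF// baseT_point_gt0// addn_gt0 i0.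
by rewrite /bary /point addnAC !mxE; field.
Qed.


(** * The inequalities of the braxtope *)

Local Ltac lia_if := rewrite /= ?eqxx; repeat (case: ifP => ?); lia.

Section Braxtope.
Variable n : nat.
Hypothesis Dn : (D < n)%N.

Definition ineqT i := functional (seqT (i + D)) 1.
(** On the indices D + 1, ..., n + D of the vertices, seqG D.+1 is nonnegative and
    seqG n.+1 is nonpositive. The case j = 1 is the facet called T_0 in the definition of a braxtope. *)
Definition ineqE j :=
  if j == 1%N then functional (seqG D.+1) 0 else
  if j == n then functional (fun m => - seqG n.+1 m) 0 else functional (seqE (j + D)) 0.

Definition incT i k := (i <= k <= i + D)%N.
Definition incE j k := (k == 0%N) ||
  (if j == 1%N then (k <= D)%N else if j == n then (n - D < k)%N
   else (0 < (k - j) + (j - k) < D)%N).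

Let nonneg_zero_iff (a : R) (z : bool) := 0 <= a /\ (a == 0) = z.

Lemma ineqT_point i k : (0 < i)%N -> nonneg_zero_iff (affine_val (ineqT i) (point k)) (incT i k).
Proof.
move=> i0; rewrite /nonneg_zero_iff /incT; have [->|k0] := posnP k.
  by rewrite functional_point0 ler01 oner_eq0 leqNgt i0.
rewrite functional_point//; last exact: seqT_solves.
have t0 := baseT_point_gt0 k0.
rewrite mulf_eq0 invr_eq0 (gt_eqF t0) orbF pmulr_lge0 ?invr_gt0//.
rewrite /seqT.
have [ki|ik] := ltnP k i.
  rewrite baseT_eq0; last by lia.
  have := @baseT_gt0 (i + D + D - (k + D)) ltac:(lia).
  by move=> h; rewrite add0r ltW// gt_eqF.
have [ki|ik'] := leqP k (i + D).
  by rewrite !baseT_eq0 ?addr0 ?lexx ?eqxx//; lia.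
rewrite addrC baseT_eq0; last by lia.
have := @baseT_gt0 (k + D - (i + D)) ltac:(lia).
by move=> h; rewrite add0r ltW// gt_eqF.
Qed.

Lemma ineqE_point j k : (1 <= j <= n)%N -> (k <= n)%N ->
  nonneg_zero_iff (affine_val (ineqE j) (point k)) (incE j k).
Proof.
move=> jn kn; rewrite /nonneg_zero_iff /incE /ineqE; have [->|k0] := posnP k.
  by case: ifP => _; [|case: ifP => _]; rewrite functional_point0 lexx eqxx.
have t0 := baseT_point_gt0 k0; rewrite /=.
have pos (x : nat -> R) : solves 0 x ->
    (0 <= affine_val (functional x 0) (point k)) = (0 <= x (k + D)%N) /\
    (affine_val (functional x 0) (point k) == 0) = (x (k + D)%N == 0).
  move=> xP; rewrite functional_point// mulf_eq0 invr_eq0 (gt_eqF t0) orbF.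
  by rewrite pmulr_lge0 ?invr_gt0.
have [j1|j1] := eqVneq j 1%N.
  have [-> ->] := pos _ (seqG_solves D.+1).
  rewrite /seqG (@baseG_eq0 (_ - (k + D))); last by lia.
  rewrite subr0; have [kD|Dk] := leqP k D.
    by rewrite baseG_eq0 ?lexx ?eqxx//; lia.
  have := @baseG_gt0 (k + D - (1 + D)) ltac:(lia).
  by move=> h; rewrite ltW// gt_eqF.
have [jn'|jn'] := eqVneq j n.
  have [-> ->] := pos _ (solvesN (seqG_solves n.+1)).
  rewrite /seqG (@baseG_eq0 (_ - n.+1)); last by lia.
  rewrite sub0r opprK; have [kD|Dk] := ltnP (n - D) k.
    by rewrite baseG_eq0 ?lexx ?eqxx//; lia.
  have := @baseG_gt0 (n.+1 + D - 1 - (k + D)) ltac:(lia).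
  by move=> h; rewrite ltW// gt_eqF.
have [-> ->] := pos _ (seqE_solves (j + D)).
rewrite /seqE (_ : _ + _ = k - j + (j - k))%N; last by lia.
have [->|kj] := posnP (k - j + (j - k)); first by rewrite baseE_at_0// ler01 oner_eq0.
have [kD|Dk] := ltnP (k - j + (j - k)) D.
  by rewrite baseE_eq0 ?lexx ?eqxx//; lia.
by have h := @baseE_gt0 _ Dk; rewrite ltW// gt_eqF.
Qed.

Definition ineqs := [seq ineqT i | i <- iota 1 (n - D)] ++ [seq ineqE j | j <- iota 1 n].

Lemma ineqsP h : h \in ineqs <->
  (exists2 i, (1 <= i <= n - D)%N & h = ineqT i) \/
  (exists2 j, (1 <= j <= n)%N & h = ineqE j).
Proof.
rewrite mem_cat; split.
  move=> /orP[] /mapP[i]; rewrite mem_iota => /andP[i1 i2] ->.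
    by left; exists i => //; lia.
  by right; exists i => //; lia.
move=> [[i i1 ->]|[i i1 ->]]; apply/orP; [left|right]; apply: map_f;
  rewrite mem_iota; lia.
Qed.

Let Y := [set point k | k in [set k | (k <= n)%N]].

Lemma ineqs_valid h p : h \in ineqs -> Y p -> 0 <= affine_val h p.
Proof.
move=> /ineqsP[[i /andP[i0 _] ->]|[j jn ->]] [k kn <-].
  by have [] := ineqT_point k i0.
by have [] := ineqE_point jn kn.
Qed.

(** The facet E_j contains all vertices but one of some simplex of the
    triangulation, so that its inequality is a barycentric coordinate there. *)
Lemma ineqE_window j : (1 <= j <= n)%N -> exists i k,
  [/\ (1 <= i <= n - D)%N, (k <= D)%N, ineqE j = functional (dual (i + D) k) 0
    & forall l, (l <= D)%N -> l != k -> incE j (i + l)].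
Proof.
move=> jn; rewrite /ineqE /incE.
have [_|j1] := eqVneq j 1%N.
  exists 1%N, D; split => //; first by lia.
    by rewrite /dual eqxx gtn_eqF.
  by move=> l lD lk; apply/orP; right; lia.
have [_|jn'] := eqVneq j n.
  exists (n - D)%N, 0%N; split => //; first by lia.
    by rewrite /dual eqxx subnK// ltnW.
  by move=> l lD lk; apply/orP; right; lia.
exists (minn (j - 1) (n - D)), (j - minn (j - 1) (n - D))%N.
have kD : (0 < j - minn (j - 1) (n - D) < D)%N by lia.
split; [lia|lia| |].
  rewrite /dual gtn_eqF ?ltn_eqF; [|lia|lia].
  by congr (functional (seqE _) _); lia.
by move=> l lD lk; apply/orP; right; lia.
Qed.

(** A point where all the inequalities hold lies in the simplex at which seqG
    changes sign: the two extreme barycentric coordinates are nonnegative by the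
    choice of that simplex, and the others because they are inequalities of
    the system. *)
Lemma ineqs_complete v : (forall h, h \in ineqs -> 0 <= affine_val h v) ->
  convex_hull Y v.
Proof.
move=> v_ge0.
have hT_ge0 i : (1 <= i <= n - D)%N -> 0 <= affine_val (ineqT i) v.
  by move=> i1; apply/v_ge0/ineqsP; left; exists i.
have hE_ge0 j : (1 <= j <= n)%N -> 0 <= affine_val (ineqE j) v.
  by move=> i1; apply/v_ge0/ineqsP; right; exists j.
pose g i := affine_val (functional (seqG (i + D)) 0) v.
have [|||i i1 /andP[gi1 gi]] := @sign_change _ g 1 (n - D).+1.
- by lia.
- by have := hE_ge0 1%N ltac:(lia); rewrite /ineqE eqxx.
- have := hE_ge0 n ltac:(lia); rewrite /ineqE gtn_eqF ?eqxx//; last by lia.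
  by rewrite functionalN /g addSn subnK ?oppr_ge0// ltnW.
have i0 : (0 < i)%N by lia.
rewrite (bary_decomposition v i0).
apply: convex_set_sum => //.
- exact: convex_hull_convex.
- by apply: sub_convex_hull; exists 0%N.
- by apply: hT_ge0; lia.
- move=> [k kD]; rewrite /bary/= pmulr_rge0; last first.
    by apply: baseT_point_gt0 => //; lia.
  have [->|k0] := eqVneq k 0%N; first by rewrite /dual eqxx functionalN oppr_ge0.
  have [->|kD'] := eqVneq k D; first by rewrite /dual eqxx gtn_eqF.
  have := hE_ge0 (i + k)%N ltac:(lia).
  rewrite /ineqE /dual (negbTE k0) (negbTE kD') gtn_eqF ?ltn_eqF; [|lia|lia].
  by rewrite addnAC.
- move=> [k kD] _; apply: sub_convex_hull; exists (i + k)%N => //=; lia.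
- exact: sum_bary.
Qed.

Lemma ineqs_normal_neq0 h : h \in ineqs -> h.1 != 0.
Proof.
move=> hL; apply/eqP => h0.
have hconst p q : affine_val h p = affine_val h q.
  by rewrite /affine_val h0 /dotr !big1// => k _; rewrite mxE mul0r.
move: hL hconst => /ineqsP[[i /andP[i0 _] ->]|[j jn ->]] hconst.
  have [_] := ineqT_point 0%N i0; have [_] := ineqT_point i i0.
  rewrite (hconst _ (point 0)) => -> ; rewrite /incT; lia.
have [_] := ineqE_point jn (leq0n _).
pose k := if j == 1%N then n else if j == n then 1%N else j.
(* The point k is off the facet E_j. *)
have kn : (k <= n)%N by rewrite /k; lia_if.
have [_] := ineqE_point jn kn.
by rewrite (hconst _ (point 0)) => ->; rewrite /incE /k; lia_if.
Qed.

Lemma points_span : affine_hull Y = setT.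
Proof.
apply/seteqP; split=> // v _; rewrite (@bary_decomposition 1 v)//.
apply: affine_set_sum; [exact: affine_hull_affine| | |exact: sum_bary].
  by apply: sub_affine_hull; exists 0%N.
by move=> [k kD] _; apply: sub_affine_hull; exists (1 + k)%N => //=; lia.
Qed.

(** Each hyperplane is spanned by the vertices of a facet of one of the simplices:
    one barycentric coordinate is zero on it, and the other vertices satisfy the
    equation. *)
Lemma ineqs_span h : h \in ineqs ->
  [set v | affine_val h v = 0] `<=` affine_hull (Y `&` [set v | affine_val h v = 0]).
Proof.
move=> /ineqsP[[i i1 ->]|[j jn ->]] v /= hv.
  have i0 : (0 < i)%N by lia.
  have inZ k : (k <= D)%N -> (Y `&` [set v | affine_val (ineqT i) v = 0]) (point (i + k)).
    move=> kD; split; first by exists (i + k)%N => //=; lia.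
    have [_ E] := ineqT_point (i + k) i0; apply/eqP; rewrite E /incT; lia.
  have sum1 := sum_bary i v; rewrite -/(ineqT i) hv in sum1.
  rewrite (bary_decomposition v i0) -/(ineqT i) hv scale0r -[X in X + _](scale0r (point i)).
  apply: affine_set_sum => //; first exact: affine_hull_affine.
    by apply: sub_affine_hull; rewrite -[i in point i]addn0; exact: inZ.
  by move=> [k kD] _; apply: sub_affine_hull; apply: inZ.
have [i [k [i1 kD hjE onZ]]] := ineqE_window jn.
have i0 : (0 < i)%N by lia.
have inZ l : (l <= n)%N -> incE j l -> (Y `&` [set v | affine_val (ineqE j) v = 0]) (point l).
  move=> ln lj; split; first by exists l.
  by have [_ E] := ineqE_point jn ln; apply/eqP; rewrite E.
rewrite (bary_decomposition v i0).
apply: affine_set_sum; [exact: affine_hull_affine| | |exact: sum_bary].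
  by apply: sub_affine_hull; exact: inZ.
move=> [l lD]; rewrite /bary/= => bl; apply: sub_affine_hull; apply: inZ.
  by lia.
apply: onZ => //; apply: contraNneq bl => ->.
by rewrite -hjE hv mulr0.
Qed.

(** For l between 2 and n - 1 the facet E_l contains all the vertices near l other
    than l itself, while the vertices far from l are in a simplex of consecutive
    vertices that avoids l; the extreme values of k and l need other choices. *)
Lemma ineqs_separate k l : (k <= n)%N -> (l <= n)%N -> k != l ->
  exists h, [/\ h \in ineqs, affine_val h (point k) = 0 & affine_val h (point l) != 0].
Proof.
move=> kn ln kl.
have useT i : (1 <= i <= n - D)%N -> incT i k -> ~~ incT i l ->
    exists h, [/\ h \in ineqs, affine_val h (point k) = 0 & affine_val h (point l) != 0].
  move=> i1 ik il; have i0 : (0 < i)%N by lia.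
  have [[_ Ek] [_ El]] := (ineqT_point k i0, ineqT_point l i0).
  exists (ineqT i); split; [by apply/ineqsP; left; exists i|..].
    by apply/eqP; rewrite Ek.
  by rewrite El.
have useE j : (1 <= j <= n)%N -> incE j k -> ~~ incE j l ->
    exists h, [/\ h \in ineqs, affine_val h (point k) = 0 & affine_val h (point l) != 0].
  move=> jn ik il; have [[_ Ek] [_ El]] := (ineqE_point jn kn, ineqE_point jn ln).
  exists (ineqE j); split; [by apply/ineqsP; right; exists j|..].
    by apply/eqP; rewrite Ek.
  by rewrite El.
have [l0|l0] := posnP l.
  by apply: (useT (minn k (n - D))); rewrite /incT; lia.
have [k0|k0] := posnP k.
  have [l1|l1] := eqVneq l 1%N; first by apply: (useE n); rewrite /incE; lia_if.
  have [ln'|ln'] := eqVneq l n; first by apply: (useE 1%N); rewrite /incE; lia_if.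
  by apply: (useE l); rewrite /incE; lia_if.
have [kl'|lk] := ltnP k l.
  have [lkD|klD] := leqP (k + D) l.
    have [k1|k1] := eqVneq k 1%N; first by apply: (useE 1%N); rewrite /incE; lia_if.
    by apply: (useT (k - 1)%N); rewrite /incT; lia.
  have [lE|lE] := eqVneq l n; last by apply: (useE l); rewrite /incE; lia_if.
  by apply: (useE (n - D)%N); rewrite /incE; lia_if.
have [lkD|klD] := leqP (l + D) k.
  have [kE|kE] := eqVneq k n; first by apply: (useE n); rewrite /incE; lia_if.
  by apply: (useT (k - D).+1); rewrite /incT; lia.
have [lE|lE] := eqVneq l 1%N; last by apply: (useE l); rewrite /incE; lia_if.
by apply: (useE D.+1); rewrite /incE; lia_if.
Qed.

(** * Comparison with the facets of a braxtope *)

Let x (k : 'I_n.+1) : 'rV[R]_D.+1 := point k.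

Lemma vtxE t : vtx x t = point (minn t n).
Proof. by rewrite /vtx /x inordK// ltnS geq_minr. Qed.

Lemma rangeE : range x = Y.
Proof.
apply/seteqP; split=> p /= [k kn <-]; first by exists (val k) => //=; rewrite -ltnS.
by exists (inord k) => //; rewrite /x inordK.
Qed.

Lemma zero_setE h (z : nat -> bool) :
  (forall k, (k <= n)%N -> (affine_val h (point k) == 0) = z k) ->
  Y `&` [set v | affine_val h v = 0] = [set point k | k in [set k | (k <= n)%N && z k]].
Proof.
move=> hz; apply/seteqP; split=> p /=.
  by move=> [[k kn <-] /eqP]; rewrite hz// => zk; exists k => //; apply/andP.
move=> [k /andP[kn zk] <-]; split; first by exists k.
by apply/eqP; rewrite hz.
Qed.

Lemma facetT_ineqT i : (1 <= i <= n - D)%N ->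
  facetT D.+1 x i = convex_hull (Y `&` [set v | affine_val (ineqT i) v = 0]).
Proof.
move=> i1; have i0 : (0 < i)%N by lia.
rewrite (@zero_setE _ (incT i)) => [|k kn]; last by have [] := ineqT_point k i0.
congr convex_hull; apply/seteqP; split=> p /= [k kP <-].
  by exists (minn (i + k) n); rewrite ?vtxE// /incT; lia.
move: kP; rewrite /incT => kP; exists (k - i)%N; first by lia.
by rewrite vtxE; congr point; lia.
Qed.

Lemma facetT0_ineqE : facetT D.+1 x 0 = convex_hull (Y `&` [set v | affine_val (ineqE 1) v = 0]).
Proof.
have n1 : (1 <= 1 <= n)%N by lia.
rewrite (@zero_setE _ (incE 1)) => [|k kn]; last by have [] := ineqE_point n1 kn.
congr convex_hull; apply/seteqP; split=> p /= [k kP <-].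
  by exists (minn (0 + k) n); rewrite ?vtxE// /incE; lia_if.
move: kP; rewrite /incE => /= kP; exists k; first by lia.
by rewrite vtxE; congr point; lia.
Qed.

Lemma facetE_ineqE j : (2 <= j <= n)%N ->
  facetE D.+1 x j = convex_hull (Y `&` [set v | affine_val (ineqE j) v = 0]).
Proof.
move=> j2; have j1 : (1 <= j <= n)%N by lia.
rewrite (@zero_setE _ (incE j)) => [|k kn]; last by have [] := ineqE_point j1 kn.
congr convex_hull; apply/seteqP; split=> p /=.
  move=> [[->|[k kP <-]]|[k kP <-]]; rewrite vtxE.
  - by exists (minn 0 n) => //; rewrite /incE; lia.
  - by exists (minn (j - k) n) => //; rewrite /incE; lia_if.
  - by exists (minn (j + k) n) => //; rewrite /incE; lia_if.
move=> [k]; rewrite /incE => /andP[kn kP] <-.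
have [k0|k0] := posnP k.
  by left; left; rewrite vtxE; congr point; lia.
have [jk|kj] := leqP j k.
  right; exists (if k == j then 1%N else k - j)%N; last first.
    by rewrite vtxE; congr point; move: kP; lia_if.
  by move: kP; lia_if.
left; right; exists (j - k)%N; last first.
  by rewrite vtxE; congr point; lia.
by move: kP; lia_if.
Qed.

Lemma point_inj k l : (k <= n)%N -> (l <= n)%N -> point k = point l -> k = l.
Proof.
move=> kn ln kl; apply/eqP; apply: contraT => /(ineqs_separate kn ln)[h [_]].
by rewrite kl => ->; rewrite eqxx.
Qed.

Lemma braxtope_point : braxtope D.+1 (convex_hull (range x)) x.
Proof.
rewrite rangeE; split.
- by rewrite Dn andbT.
- split; last by apply: has_dim_full; rewrite affine_hull_convex_hull points_span.
  exists Y => //; rewrite -rangeE; exact: finite_image.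
- split.
    move=> k l /point_inj kl; apply/val_inj/kl; by rewrite -ltnS.
  rewrite rangeE (vertices_convex_hull ineqs_valid)// => p q [k kn <-] [l ln <-] kl.
  by apply: ineqs_separate => //; apply: contraNneq kl => ->.
- move=> F; rewrite (is_facet_hull_zero_set ineqs_valid ineqs_complete
    ineqs_normal_neq0 ineqs_span points_span); split.
    move=> [h /ineqsP[[i i1 ->] ->|[j j1 ->] ->]].
      by left; exists i; [lia|rewrite facetT_ineqT].
    have [->|j1'] := eqVneq j 1%N.
      by left; exists 0%N; rewrite ?facetT0_ineqE.
    by right; exists j; [lia|rewrite facetE_ineqE//; lia].
  move=> [[i i1 ->]|[j j1 ->]].
    have [->|i0] := posnP i.
      rewrite facetT0_ineqE; exists (ineqE 1) => //; apply/ineqsP; right.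
      by exists 1%N => //; lia.
    rewrite facetT_ineqT; last by lia.
    by exists (ineqT i) => //; apply/ineqsP; left; exists i => //; lia.
  rewrite facetE_ineqE//; exists (ineqE j) => //; apply/ineqsP; right.
  by exists j => //; lia.
Qed.

End Braxtope.
End Realization.

Theorem theorem1 (R : realType) (n d : nat) (hd : (3 <= d)%N)
    (hn : (d <= n)%N) :
  exists (P : set 'rV[R]_d) (x : 'I_n.+1 -> 'rV[R]_d), braxtope d P x.
Proof.
case: d hd hn => [//|D] D1 Dn.
by eexists; eexists; apply: braxtope_point.
Qed.
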